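(* The map $\Gamma:\mathcal{X}^5\to\mathcal{X}$ takes the following diagonal values: (1) (diagonal $x=y$) For all $(x,a,b,z)\in\mathcal{X}^4$, $$\Gamma(x,a,x,b,z)=(z\lor(x\land a))\land(b\lor x).$$ In particular, for all $x,a,b,z\in\mathcal{X}$: (i) $\Gamma(x,a,x,b,x)=x$; (ii) $\Gamma(x,x,x,b,z)=(z\lor x)\land(b\lor x)$; (iii) $\Gamma(x,x,x,z,z)=z\lor x$; (iv) $\Gamma(x,a,x,x,z)=(z\lor(x\land a))\land x$; (v) $\Gamma(x,a,x,x,a)=a\land x$; (vi) $\Gamma(x,a,x,b,a)=a\land(b\lor x)$; (vii) $\Gamma(x,a,x,a,z)=(z\lor(x\land a))\land(x\lor a)$; (viii) $\Gamma(x,a,x,z,z)=z\lor(x\land a)$. (2) (diagonal $a=z$) For all $(x,a,y,b)\in\mathcal{X}^4$, $$\Gamma(x,a,y,b,a)=a\land\bigl(b\lor(x\land(y\lor a))\bigr).$$ In particular, on the subdiagonal $x=b$ we have, for all $x,a,y\in\mathcal{X}$, $\Gamma(x,a,y,x,a)=a\land x$. (3) (diagonal $b=z$) For all $(x,a,y,b)\in\mathcal{X}^4$, $$\Gamma(x,a,y,b,b)=b\lor\bigl(a\land(x\lor(y\land b))\bigr).$$ In particular, on the subdiagonal $b=z$, $x=a$ we have, for all $a,y,b\in\mathcal{X}$, $\Gamma(a,a,y,b,b)=b\lor a$, and on $a=b=z$, for all $x,a,y\in\mathcal{X}$, $\Gamma(x,a,y,a,a)=a$.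
   Context: $\mathbb{B}$ is an associative unital algebra over a commutative unital ring $\mathbb{K}$, $W$ a right $\mathbb{B}$-module, $\mathcal{X}=\mathrm{Gras}_{\mathbb{B}}(W)$ the set of all $\mathbb{B}$-submodules of $W$, with $x\land y=x\cap y$ and $x\lor y=x+y$. The map $\Gamma:\mathcal{X}^5\to\mathcal{X}$ is defined by $$\Gamma(x,a,y,b,z)=\{\omega\in W:\ \exists\,\xi\in x,\alpha\in a,\eta\in y,\beta\in b,\zeta\in z:\ \omega=\zeta+\alpha=\alpha+\eta+\beta=\xi+\beta\}.$$ *)

(* Defs.v *)
From HB Require Import structures.
From mathcomp Require Import all_boot all_algebra.
From mathcomp Require Import boolp.
Set Implicit Arguments.
Unset Strict Implicit.
Unset Printing Implicit Defensive.
Import GRing.Theory.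
Local Open Scope ring_scope.

(* Modules over [R] are left modules in the library.  A right B-module is a    *)
(* left module over the converse ring [B^c], w.b being [(b : B^c) *: w]; the   *)
(* submodules are then the inhabitants of [submodClosed W], i.e. the boolean   *)
(* predicates on W closed under 0, + and scaling.  In the presence of          *)
(* classical logic every subset of W is given by a boolean predicate.          *)
Notation Gras W := (submodClosed W).

Section Grassmannian.
Variables (R : pzRingType) (W : lmodType R).
Implicit Types x y z a b : Gras W.

Lemma gras_ext x y : x =i y -> x = y.
Proof.
case: x y => [f [[f0] [fZ]]] [g [[g0] [gZ]]] /= fg.
have {fg} E : f = g by apply: funext => w; exact: fg.
case: g / E g0 gZ => g0 gZ.
congr GRing.SubmodClosed.Pack; congr GRing.SubmodClosed.Class;
  [congr GRing.isAddClosed.Axioms_ | congr GRing.isScaleClosed.Axioms_];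
  apply: Prop_irrelevance.
Qed.

Definition meet_pred x y : {pred W} := fun w => (w \in x) && (w \in y).

Fact meet_closed x y : subsemimod_closed (meet_pred x y).
Proof.
split; first split.
- by apply/andP; rewrite !rpred0.
- by move=> u v /andP[? ?] /andP[? ?]; apply/andP; split; apply: rpredD.
- by move=> c u /andP[? ?]; apply/andP; split; apply: rpredZ.
Qed.

Definition meet x y : Gras W :=
  HB.pack (meet_pred x y)
    (GRing.isSubSemiModClosed.Build R W _ (meet_closed x y)).

Definition join_pred x y : {pred W} := fun w =>
  `[< exists u v : W, [/\ u \in x, v \in y & w = u + v] >].

Fact join_closed x y : subsemimod_closed (join_pred x y).
Proof.
split; first split.
- by apply/asboolP; exists 0, 0; rewrite !rpred0 addr0.
- move=> _ _ /asboolP[u [v [ux vy ->]]] /asboolP[u' [v' [ux' vy' ->]]].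
  by apply/asboolP; exists (u + u'), (v + v'); rewrite !rpredD// addrACA.
- move=> c _ /asboolP[u [v [ux vy ->]]]; apply/asboolP.
  by exists (c *: u), (c *: v); rewrite !rpredZ// scalerDr.
Qed.

Definition join x y : Gras W :=
  HB.pack (join_pred x y)
    (GRing.isSubSemiModClosed.Build R W _ (join_closed x y)).

Definition Gamma_pred x a y b z : {pred W} := fun w =>
  `[< exists xi alpha eta beta zeta : W,
      [/\ xi \in x, alpha \in a, eta \in y, beta \in b & zeta \in z] /\
      [/\ w = zeta + alpha, w = alpha + eta + beta & w = xi + beta] >].

Fact Gamma_closed x a y b z : subsemimod_closed (Gamma_pred x a y b z).
Proof.
split; first split.
- by apply/asboolP; exists 0, 0, 0, 0, 0; rewrite !rpred0 !addr0.
- move=> w w' /asboolP[k [l [e [t [s [[kx la ey tb sz] [E1 E2 E3]]]]]]].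
  move=> /asboolP[k' [l' [e' [t' [s' [[kx' la' ey' tb' sz'] [F1 F2 F3]]]]]]].
  apply/asboolP; exists (k + k'), (l + l'), (e + e'), (t + t'), (s + s').
  split; first by rewrite !rpredD.
  split; first by rewrite E1 F1 addrACA.
  - by rewrite E2 F2 addrACA; congr (_ + _); rewrite addrACA.
  - by rewrite E3 F3 addrACA.
- move=> c w /asboolP[k [l [e [t [s [[kx la ey tb sz] [E1 E2 E3]]]]]]].
  apply/asboolP; exists (c *: k), (c *: l), (c *: e), (c *: t), (c *: s).
  split; first by rewrite !rpredZ.
  by rewrite -!scalerDr; split; congr (_ *: _).
Qed.

Definition Gamma x a y b z : Gras W :=
  HB.pack (Gamma_pred x a y b z)
    (GRing.isSubSemiModClosed.Build R W _ (Gamma_closed x a y b z)).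

End Grassmannian.

Declare Scope gras_scope.
Delimit Scope gras_scope with gras.
Notation "x ⊓ y" := (meet x y) (at level 48, left associativity) : gras_scope.
Notation "x ⊔ y" := (join x y) (at level 52, left associativity) : gras_scope.

(* Main.v *)
(* Cancelling beta in the last two expressions for omega gives xi = alpha + eta,
   so each of xi, alpha, eta is a signed sum of the other two.  On each diagonal
   this relation puts one of them in an intersection, which is the inclusion
   from left to right; read backwards, it supplies the missing witnesses. *)
Require Import Defs.
From mathcomp Require Import all_boot all_algebra.
From mathcomp Require Import boolp.
Import GRing.Theory.
Local Open Scope ring_scope.
Local Open Scope gras_scope.

Section GrassmannianLattice.
Variables (R : pzRingType) (W : lmodType R).
Implicit Types (x y z a b : Gras W) (u v w : W).

(** The structure records closure under 0, + and scaling only; opposites come from the scalar -1. *)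
Lemma gras_opp x u : u \in x -> - u \in x.
Proof. by move=> ux; rewrite -scaleN1r rpredZ. Qed.

Lemma gras_sub x u v : u \in x -> v \in x -> u - v \in x.
Proof. by move=> ux vx; rewrite rpredD ?gras_opp. Qed.

Lemma in_meet x y w : (w \in x ⊓ y) = (w \in x) && (w \in y).
Proof. by []. Qed.

Lemma joinP x y w :
  reflect (exists u v, [/\ u \in x, v \in y & w = u + v]) (w \in x ⊔ y).
Proof. exact: asboolP. Qed.

Lemma GammaP x a y b z w :
  reflect (exists xi alpha eta beta zeta : W,
      [/\ xi \in x, alpha \in a, eta \in y, beta \in b & zeta \in z] /\
      [/\ w = zeta + alpha, w = alpha + eta + beta & w = xi + beta])
    (w \in Gamma x a y b z).
Proof. exact: asboolP. Qed.

Lemma meetC x y : x ⊓ y = y ⊓ x.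
Proof. by apply: gras_ext => w; rewrite !in_meet andbC. Qed.

Lemma meetxx x : x ⊓ x = x.
Proof. by apply: gras_ext => w; rewrite in_meet andbb. Qed.

Lemma joinC x y : x ⊔ y = y ⊔ x.
Proof.
by apply: gras_ext => w; apply/joinP/joinP => -[u [v [? ? ->]]];
  exists v, u; rewrite addrC.
Qed.

Lemma mem_joinl x y w : w \in x -> w \in x ⊔ y.
Proof. by move=> wx; apply/joinP; exists w, 0; rewrite rpred0 addr0. Qed.

Lemma joinKI x y : x ⊓ (x ⊔ y) = x.
Proof.
by apply: gras_ext => w; rewrite in_meet andb_idr // => /mem_joinl.
Qed.

Lemma meetKU x y : x ⊔ (x ⊓ y) = x.
Proof.
apply: gras_ext => w; apply/joinP/idP => [[u [v [ux]]]|wx].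
  by rewrite in_meet => /andP[vx _] ->; rewrite rpredD.
by exists w, 0; rewrite !rpred0 addr0.
Qed.

Lemma joinxx x : x ⊔ x = x.
Proof. by rewrite -{2}(meetxx x) meetKU. Qed.

(** With eta in [x], alpha = xi - eta lies in [x ⊓ a]. Conversely the two decompositions of w supply
    all the witnesses but eta, and eta = xi - alpha reconciles them. *)
Lemma Gamma_diag_xy x a b z :
  Gamma x a x b z = (z ⊔ (x ⊓ a)) ⊓ (b ⊔ x).
Proof.
apply: gras_ext => w; rewrite in_meet.
apply/GammaP/andP => [[xi [al [et [be [ze [[xix ala etx beb zez] [E1 E2 E3]]]]]]]|].
  have alE : al = xi - et.
    by apply/eqP; rewrite eq_sym subr_eq -(inj_eq (addIr be)) -E2 -E3.
  split; apply/joinP; last by exists be, xi; rewrite addrC.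
  by exists ze, al; rewrite in_meet ala {1}alE gras_sub.
case=> /joinP[ze [al [zez]]]; rewrite in_meet => /andP[alx ala] wE.
move=> /joinP[be [xi [beb xix wE']]].
exists xi, al, (xi - al), be, ze; split; first by rewrite gras_sub.
by rewrite (addrC xi be) (addrC al) subrK (addrC xi).
Qed.

(** Here w = zeta + alpha is a sum in [a], and xi = eta + alpha lies in [x ⊓ (y ⊔ a)]. *)
Lemma Gamma_diag_az x a y b :
  Gamma x a y b a = a ⊓ (b ⊔ (x ⊓ (y ⊔ a))).
Proof.
apply: gras_ext => w; rewrite in_meet.
apply/GammaP/andP => [[xi [al [et [be [ze [[xix ala ety beb zea] [E1 E2 E3]]]]]]]|].
  split; first by rewrite E1 rpredD.
  have xiE : xi = et + al.
    by apply: (addIr be); rewrite -E3 E2 (addrC et).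
  apply/joinP; exists be, xi; split; rewrite ?(addrC be) // in_meet xix.
  by apply/joinP; exists et, al.
case=> wa /joinP[be [xi [beb]]]; rewrite in_meet => /andP[xix].
move=> /joinP[et [al [ety ala xiE]]] wE.
(* The choice of zeta is forced; it lies in [a] because w and alpha do. *)
exists xi, al, et, be, (w - al); split; first by rewrite gras_sub.
by rewrite subrK (addrC al) -xiE (addrC xi).
Qed.

(** Comparing the first two expressions for omega gives eta = zeta - beta, which is in [b]; so alpha
    = xi - eta lies in [x ⊔ (y ⊓ b)]. *)
Lemma Gamma_diag_bz x a y b :
  Gamma x a y b b = b ⊔ (a ⊓ (x ⊔ (y ⊓ b))).
Proof.
apply: gras_ext => w.
apply/GammaP/joinP => [[xi [al [et [be [ze [[xix ala ety beb zeb] [E1 E2 E3]]]]]]]|].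
  have etE : et = ze - be.
    apply/eqP; rewrite eq_sym subr_eq; apply/eqP/(addIr al).
    by rewrite -E1 E2 [RHS]addrC addrA.
  have alE : al = xi - et.
    by apply/eqP; rewrite eq_sym subr_eq -(inj_eq (addIr be)) -E2 -E3.
  exists ze, al; split=> //; rewrite in_meet ala; apply/joinP.
  by exists xi, (- et); rewrite in_meet gras_opp // {1}etE gras_opp // gras_sub.
case=> ze [al [zeb]]; rewrite in_meet => /andP[ala /joinP[xi [v [xix]]]].
rewrite in_meet => /andP[vy vb] alE wE.
(* As alpha = xi + v, eta must be -v, and w = ze + (xi + v) = xi + (ze + v) dictates beta. *)
exists xi, al, (- v), (ze + v), ze; split; first by rewrite gras_opp // rpredD.
by rewrite wE alE addrK addrCA.
Qed.

End GrassmannianLattice.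

Theorem theorem2p4 (K : comPzRingType) (B : pzRingType)
    (* B is an associative unital K-algebra, with structure map iota *)
    (iota : {rmorphism K -> B})
    (iota_central : forall (k : K) (b : B), iota k * b = b * iota k)
    (W : lmodType B^c) :
  (* (1) *)
  ((forall x a b z : Gras W,
      Gamma x a x b z = (z ⊔ (x ⊓ a)) ⊓ (b ⊔ x)) /\
   (* (i) *)
   (forall x a b : Gras W, Gamma x a x b x = x) /\
   (* (ii) *)
   (forall x b z : Gras W, Gamma x x x b z = (z ⊔ x) ⊓ (b ⊔ x)) /\
   (* (iii) *)
   (forall x z : Gras W, Gamma x x x z z = z ⊔ x) /\
   (* (iv) *)
   (forall x a z : Gras W, Gamma x a x x z = (z ⊔ (x ⊓ a)) ⊓ x) /\
   (* (v) *)
   (forall x a : Gras W, Gamma x a x x a = a ⊓ x) /\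
   (* (vi) *)
   (forall x a b : Gras W, Gamma x a x b a = a ⊓ (b ⊔ x)) /\
   (* (vii) *)
   (forall x a z : Gras W, Gamma x a x a z = (z ⊔ (x ⊓ a)) ⊓ (x ⊔ a)) /\
   (* (viii) *)
   (forall x a z : Gras W, Gamma x a x z z = z ⊔ (x ⊓ a))) /\
  (* (2) *)
  ((forall x a y b : Gras W,
      Gamma x a y b a = a ⊓ (b ⊔ (x ⊓ (y ⊔ a)))) /\
   (forall x a y : Gras W, Gamma x a y x a = a ⊓ x)) /\
  (* (3) *)
  ((forall x a y b : Gras W,
      Gamma x a y b b = b ⊔ (a ⊓ (x ⊔ (y ⊓ b)))) /\
   (forall a y b : Gras W, Gamma a a y b b = b ⊔ a) /\
   (forall x a y : Gras W, Gamma x a y a a = a)).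
Proof.
(* Trying a = z and b = z before x = y lets absorption settle Gamma(x,a,x,z,z) up to
   commutativity. *)
do !split=> *; rewrite ?(Gamma_diag_az, Gamma_diag_bz) ?Gamma_diag_xy.
all: rewrite ?meetxx ?joinxx ?joinKI ?meetKU //.
(* Left over, in order: Gamma(x,a,x,b,x), Gamma(x,a,x,x,a), Gamma(x,a,x,a,z) and
   Gamma(x,a,x,z,z). *)
- by rewrite joinC joinKI.
- by rewrite joinxx.
- by congr (_ ⊓ _); rewrite joinC.
- by congr (_ ⊔ _); rewrite meetC.
Qed.
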